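(* Let $p$ be a prime, let $G$ be a finite $p$-group of order $|G|\ge p^2$ and $\Lambda:=\mathbb Z_pG$. Let $\Gamma:=\mathrm{Id}(J(\Lambda))$ and $\Delta:=\mathrm{Id}(J(\Gamma))$. Then $|\Gamma/\Lambda|=p$ and $|\Delta/\Lambda|=p^2\,|G/(G'G^p)|$.
   Context: $\mathbb Z_p$ is the ring of $p$-adic integers. Orders are $\mathbb Z_p$-orders in $\mathbb Q_pG$; $J(\cdot)$ is the Jacobson radical. For a full lattice $L$ in $\mathbb Q_pG$, $\mathrm{Id}(L)=\{a\in\mathbb Q_pG: aL\subseteq L,\ La\subseteq L\}$. $G'$ is the commutator subgroup of $G$ and $G^p$ the subgroup generated by all $p$-th powers. *)

(* Defs.v *)
From HB Require Import structures.
From mathcomp Require Import all_boot all_order all_algebra.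
From mathcomp Require Import all_fingroup all_solvable.
From mathcomp Require Import boolp classical_sets functions cardinality.

Set Implicit Arguments.
Unset Strict Implicit.
Unset Printing Implicit Defensive.

Import GRing.Theory.

Local Open Scope ring_scope.

(* The canonical map Z/m -> Z/d; it is a ring morphism when d divides m. *)
Definition Zp_red (m d : nat) (x : 'Z_m) : 'Z_d := (x : nat)%:R.

Section ZpRed.
Variables (m d : nat).
Hypotheses (m_gt1 : (1 < m)%N) (d_gt1 : (1 < d)%N) (dm : (d %| m)%N).

Lemma Zp_red_mod (k : nat) : ((k %% m)%N)%:R = k%:R :> 'Z_d.
Proof. by apply: val_inj; rewrite /= !val_Zp_nat // modn_dvdm. Qed.

Lemma Zp_red_nat (k : nat) : Zp_red d (k%:R : 'Z_m) = k%:R.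
Proof. by rewrite /Zp_red val_Zp_nat // Zp_red_mod. Qed.

Lemma Zp_redD (x y : 'Z_m) : Zp_red d (x + y) = Zp_red d x + Zp_red d y.
Proof. by rewrite -[x]natr_Zp -[y]natr_Zp -natrD !Zp_red_nat natrD. Qed.

Lemma Zp_redM (x y : 'Z_m) : Zp_red d (x * y) = Zp_red d x * Zp_red d y.
Proof. by rewrite -[x]natr_Zp -[y]natr_Zp -natrM !Zp_red_nat natrM. Qed.

Lemma Zp_red0 : Zp_red d (0 : 'Z_m) = 0.
Proof. exact: (Zp_red_nat 0). Qed.

Lemma Zp_red1 : Zp_red d (1 : 'Z_m) = 1.
Proof. exact: (Zp_red_nat 1). Qed.

Lemma Zp_redN (x : 'Z_m) : Zp_red d (- x) = - Zp_red d x.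
Proof. by apply/eqP; rewrite -addr_eq0 -Zp_redD addNr Zp_red0. Qed.

End ZpRed.

(* The p-adic integers as the inverse limit of the rings Z/p^n with n > 0.
   Component n lives in Z/p^(n+1), because 'Z_(p ^ 0) would not be trivial.
   Primality is a parameter of the type since Z_p is a domain only then. *)
Record padic_int (p : nat) (p_pr : prime p) := PadicInt {
  residue : forall n : nat, 'Z_(p ^ n.+1);
  residueP : forall n : nat, Zp_red (p ^ n.+1) (residue n.+1) = residue n
}.

Section PadicInt.
Variables (p : nat) (p_pr : prime p).
Local Notation Zp := (padic_int p_pr).

HB.instance Definition _ := gen_eqMixin Zp.
HB.instance Definition _ := gen_choiceMixin Zp.

Lemma padic_intP (x y : Zp) : (forall n, residue x n = residue y n) -> x = y.
Proof.
case: x y => [x xP] [y yP] /= exy.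
have {exy} exy : x = y by apply: functional_extensionality_dep.
by rewrite -exy in yP *; rewrite (Prop_irrelevance xP yP).
Qed.

Lemma pX_gt1 n : (1 < p ^ n.+1)%N.
Proof. by rewrite -(exp1n n.+1) ltn_exp2r // prime_gt1. Qed.

Lemma pX_dvd n : (p ^ n.+1 %| p ^ n.+2)%N.
Proof. by rewrite dvdn_exp2l. Qed.

Local Hint Resolve pX_gt1 pX_dvd : core.

Definition padic0 : Zp := @PadicInt p p_pr (fun=> 0)
  (fun n => Zp_red0 (pX_gt1 _) (pX_gt1 _) (pX_dvd n)).

Definition padic1 : Zp := @PadicInt p p_pr (fun=> 1)
  (fun n => Zp_red1 (pX_gt1 _) (pX_gt1 _) (pX_dvd n)).

Fact padicN_subproof (x : Zp) n :
  Zp_red (p ^ n.+1) (- residue x n.+1) = - residue x n.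
Proof. by rewrite Zp_redN // residueP. Qed.
Definition padicN (x : Zp) : Zp := PadicInt p_pr (padicN_subproof x).

Fact padicD_subproof (x y : Zp) n :
  Zp_red (p ^ n.+1) (residue x n.+1 + residue y n.+1)
  = residue x n + residue y n.
Proof. by rewrite Zp_redD // !residueP. Qed.
Definition padicD (x y : Zp) : Zp := PadicInt p_pr (padicD_subproof x y).

Fact padicM_subproof (x y : Zp) n :
  Zp_red (p ^ n.+1) (residue x n.+1 * residue y n.+1)
  = residue x n * residue y n.
Proof. by rewrite Zp_redM // !residueP. Qed.
Definition padicM (x y : Zp) : Zp := PadicInt p_pr (padicM_subproof x y).

Fact padicDA : associative padicD.
Proof. by move=> x y z; apply: padic_intP => n /=; rewrite addrA. Qed.
Fact padicDC : commutative padicD.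
Proof. by move=> x y; apply: padic_intP => n /=; rewrite addrC. Qed.
Fact padicD0 : left_id padic0 padicD.
Proof. by move=> x; apply: padic_intP => n /=; rewrite add0r. Qed.
Fact padicDN : left_inverse padic0 padicN padicD.
Proof. by move=> x; apply: padic_intP => n /=; rewrite addNr. Qed.

HB.instance Definition _ :=
  GRing.isZmodule.Build Zp padicDA padicDC padicD0 padicDN.

Fact padicMA : associative padicM.
Proof. by move=> x y z; apply: padic_intP => n /=; rewrite mulrA. Qed.
Fact padicMC : commutative padicM.
Proof. by move=> x y; apply: padic_intP => n /=; rewrite mulrC. Qed.
Fact padicM1 : left_id padic1 padicM.
Proof. by move=> x; apply: padic_intP => n /=; rewrite mul1r. Qed.
Fact padicMD : left_distributive padicM padicD.
Proof. by move=> x y z; apply: padic_intP => n /=; rewrite mulrDl. Qed.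
Fact padic1_neq0 : padic1 != 0.
Proof.
by apply/eqP => /(congr1 (fun x : Zp => residue x 0))/eqP; rewrite /= oner_eq0.
Qed.

HB.instance Definition _ := GRing.Zmodule_isComNzRing.Build Zp
  padicMA padicMC padicM1 padicMD padic1_neq0.

Definition padic_unit : {pred Zp} := fun x => `[< exists y : Zp, y * x = 1 >].
Definition padic_inv (x : Zp) : Zp :=
  if pselect (exists y : Zp, y * x = 1) is left xU then projT1 (cid xU) else x.

Fact padic_mulVx : {in padic_unit, left_inverse 1 padic_inv *%R}.
Proof.
move=> x /asboolP xU; rewrite /padic_inv; case: pselect => // xU'.
by case: (cid xU').
Qed.
Fact padic_unitPl (x y : Zp) : y * x = 1 -> padic_unit x.
Proof. by move=> yx; apply/asboolP; exists y. Qed.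
Fact padic_invr_out : {in [predC padic_unit], padic_inv =1 id}.
Proof.
move=> x /= xU; rewrite /padic_inv; case: pselect => // xU'.
by move: xU; rewrite inE /= => /negP[]; apply/asboolP.
Qed.

HB.instance Definition _ := GRing.ComNzRing_hasMulInverse.Build Zp
  padic_mulVx padic_unitPl padic_invr_out.

Lemma residue_mod (x : Zp) n k :
  ((residue x (n + k) : nat) = residue x n %[mod p ^ n.+1])%N.
Proof.
elim: k => [|k IHk]; first by rewrite addn0.
rewrite -IHk addnS -(residueP x (n + k)) /Zp_red val_Zp_nat //.
by rewrite modn_dvdm // dvdn_exp2l // ltnS leq_addr.
Qed.

Lemma padic_neq0 (x : Zp) : x != 0 -> exists n, residue x n != 0.
Proof.
move=> x_neq0; apply: contrapT => xn; case/eqP: x_neq0.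
by apply: padic_intP => n; apply: contrapT => /eqP xn0; apply: xn; exists n.
Qed.

Lemma residue_ndvd (x : Zp) n k : residue x n != 0 ->
  ~~ (p ^ n.+1 %| residue x (n + k))%N.
Proof.
apply: contraNN; rewrite /dvdn residue_mod modn_small; first by [].
by rewrite -[X in (_ < X)%N](Zp_cast (pX_gt1 n)) ltn_ord.
Qed.

Fact padic_integral : GRing.integral_domain_axiom Zp.
Proof.
move=> x y xy0; apply: contrapT => /negP; rewrite negb_or => /andP[].
move=> /padic_neq0[n xn] /padic_neq0[m ym].
have [] := (residue_ndvd m.+1 xn, residue_ndvd n.+1 ym).
set N := (n + m.+1)%N; rewrite [(m + n.+1)%N](_ : _ = N); last first.
  by rewrite /N !addnS addnC.
move=> xN yN.
have a_gt0 : (0 < residue x N)%N by case: (nat_of_ord _) xN; rewrite ?dvdn0.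
have b_gt0 : (0 < residue y N)%N by case: (nat_of_ord _) yN; rewrite ?dvdn0.
have : residue x N * residue y N = 0.
  exact: (congr1 (fun z : Zp => residue z N) xy0).
rewrite -[residue x N]natr_Zp -[residue y N]natr_Zp -natrM.
move=> /(congr1 val) /=; rewrite val_Zp_nat // => /eqP.
rewrite -/(dvdn _ _) pfactor_dvdn ?muln_gt0 ?a_gt0 // lognM //.
move: xN yN; rewrite !pfactor_dvdn // -!leqNgt => xN yN.
have lt_nmN : (n + m < N)%N by rewrite /N addnS.
by apply/negP; rewrite -leqNgt (leq_trans (leq_add xN yN)) // ltnW.
Qed.

HB.instance Definition _ :=
  GRing.ComUnitRing_isIntegral.Build Zp padic_integral.

End PadicInt.

Definition padic (p : nat) (p_pr : prime p) := {fraction padic_int p_pr}.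

HB.instance Definition _ (p : nat) (p_pr : prime p) :=
  GRing.Field.on (padic p_pr).

(* The group algebra KG of the finite group G of all elements of gT: the
   function a stands for \sum_g a g * g, and the product is convolution. *)
Definition group_algebra (K : fieldType) (gT : finGroupType) : Type :=
  {ffun gT -> K}.

Section GroupAlgebra.
Variables (K : fieldType) (gT : finGroupType).
Local Notation KG := (group_algebra K gT).

HB.instance Definition _ := GRing.Zmodule.copy KG {ffun gT -> K}.

Definition galgZ (k : K) (a : KG) : KG := [ffun g => k * a g].

Fact galgZA (k l : K) (a : KG) : galgZ k (galgZ l a) = galgZ (k * l) a.
Proof. by apply/ffunP => g; rewrite !ffunE mulrA. Qed.
Fact galgZ1 : left_id 1 galgZ.
Proof. by move=> a; apply/ffunP => g; rewrite ffunE mul1r. Qed.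
Fact galgZDr : right_distributive galgZ +%R.
Proof. by move=> k a b; apply/ffunP => g; rewrite !ffunE mulrDr. Qed.
Fact galgZDl (a : KG) : {morph galgZ^~ a : k l / k + l}.
Proof. by move=> k l; apply/ffunP => g; rewrite !ffunE mulrDl. Qed.

HB.instance Definition _ :=
  GRing.Zmodule_isLmodule.Build K KG galgZA galgZ1 galgZDr galgZDl.

Definition galg1 : KG := [ffun g => (g == 1%g)%:R].
Definition galgM (a b : KG) : KG :=
  [ffun g => \sum_(h : gT) a h * b (h^-1 * g)%g].

Fact galgMA : associative galgM.
Proof.
move=> a b c; apply/ffunP => g; rewrite !ffunE.
under eq_bigr do rewrite ffunE big_distrr /=.
under [RHS]eq_bigr do rewrite ffunE big_distrl /=.
rewrite [RHS]exchange_big /=; apply: eq_bigr => h _.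
rewrite [RHS](reindex_inj (mulgI h)) /=; apply: eq_bigr => k _.
by rewrite mulrA mulKg invMg mulgA.
Qed.
Fact galgM1l : left_id galg1 galgM.
Proof.
move=> a; apply/ffunP => g; rewrite ffunE (bigD1 1%g) //= big1 => [|h].
  by rewrite ffunE eqxx mul1r invg1 mul1g addr0.
by rewrite ffunE => /negPf->; rewrite mul0r.
Qed.
Fact galgM1r : right_id galg1 galgM.
Proof.
move=> a; apply/ffunP => g; rewrite ffunE (bigD1 g) //= big1 => [|h hg].
  by rewrite ffunE mulVg eqxx mulr1 addr0.
by rewrite ffunE -eq_mulVg1 (negPf hg) mulr0.
Qed.
Fact galgMDl : left_distributive galgM +%R.
Proof.
move=> a b c; apply/ffunP => g; rewrite !ffunE -big_split /=.
by apply: eq_bigr => h _; rewrite ffunE mulrDl.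
Qed.
Fact galgMDr : right_distributive galgM +%R.
Proof.
move=> a b c; apply/ffunP => g; rewrite !ffunE -big_split /=.
by apply: eq_bigr => h _; rewrite ffunE mulrDr.
Qed.
Fact galg1_neq0 : galg1 != 0.
Proof. by apply/eqP => /ffunP/(_ 1%g)/eqP; rewrite !ffunE eqxx oner_eq0. Qed.

HB.instance Definition _ := GRing.Zmodule_isNzRing.Build KG
  galgMA galgM1l galgM1r galgMDl galgMDr galg1_neq0.

Fact galgZAl (k : K) (a b : KG) : k *: (a * b) = (k *: a) * b.
Proof.
apply/ffunP => g; rewrite !ffunE mulr_sumr.
by apply: eq_bigr => h _; rewrite ffunE mulrA.
Qed.
HB.instance Definition _ := GRing.Lmodule_isLalgebra.Build K KG galgZAl.

Fact galgZAr (k : K) (a b : KG) : k *: (a * b) = a * (k *: b).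
Proof.
apply/ffunP => g; rewrite !ffunE mulr_sumr.
by apply: eq_bigr => h _; rewrite ffunE mulrCA.
Qed.
HB.instance Definition _ := GRing.Lalgebra_isAlgebra.Build K KG galgZAr.

End GroupAlgebra.

Local Open Scope classical_set_scope.
Local Open Scope card_scope.

Definition integral_group_ring (p : nat) (p_pr : prime p) (gT : finGroupType) :
    set (group_algebra (padic p_pr) gT) :=
  [set a : group_algebra (padic p_pr) gT |
    forall g : gT, exists z : padic_int p_pr, a g = FracField.tofrac z].
Arguments integral_group_ring {p} p_pr gT _.

Section SubsetsOfARing.
Variable A : nzRingType.
Implicit Types R I L M : set A.

Definition left_ideal R I :=
  [/\ I `<=` R, I 0,
      forall x y, I x -> I y -> I (x - y) &
      forall r x, R r -> I x -> I (r * x)].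

Definition maximal_left_ideal R I :=
  [/\ left_ideal R I, I <> R &
      forall I', left_ideal R I' -> I `<=` I' -> I' = I \/ I' = R].

(* For R a subring of A. *)
Definition jacobson_radical R : set A :=
  [set x | R x /\ forall I, maximal_left_ideal R I -> I x].

Definition Idealizer L : set A :=
  [set a | (forall x, L x -> L (a * x)) /\ (forall x, L x -> L (x * a))].

(* L is contained in M and |M / L| = n, for additive subgroups L and M of A. *)
Definition quotient_card M L (n : nat) :=
  L `<=` M /\ [set [set x + y | y in L] | x in M] #= `I_n.

End SubsetsOfARing.

Definition power_subgroup (gT : finGroupType) (p : nat) (G : {set gT}) :
    {set gT} :=
  (<<[set x ^+ p | x in G]%SET>>)%g.

(* Main.v *)
(* Write G for the group and N for the sum of its elements.  A p-group acting on
   the annihilator of an element of F_p G has a nonzero fixed point as soon as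
   the annihilator is nonzero, and fixed points are multiples of N; hence an
   element of Lambda with unit augmentation is invertible, Lambda is local and
   J(Lambda) consists of the elements whose augmentation is divisible by p.
   Multiplying by p and by g - 1 shows that a stabilises J(Lambda) iff p a is
   integral and constant modulo p, i.e. Gamma = Lambda + Zp (N / p).  As p^2
   divides |G|, Gamma is again local with J(Gamma) cut out by the augmentation.
   The same test shows that a = p^-1 (b + c N / p) stabilises J(Gamma) iff b is
   modulo p of the form s + f with s constant and f : G -> F_p additive.  So
   Delta / Lambda is parametrised by (c mod p, s, f), and Hom(G, F_p) has as
   many elements as G / Phi(G). *)
Require Import Defs.
From HB Require Import structures.
From mathcomp Require Import all_boot all_order all_algebra.
From mathcomp Require Import all_fingroup all_solvable.
From mathcomp Require Import mxabelem ring.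
From mathcomp Require Import boolp classical_sets functions cardinality.

Set Implicit Arguments.
Unset Strict Implicit.
Unset Printing Implicit Defensive.

Import GRing.Theory.

Local Open Scope ring_scope.

(** * Homomorphisms to F_p and convolution over F_p *)

Section HomFp.
Variables (p : nat) (gT : finGroupType).

Definition hom_Fp : {set {ffun gT -> 'F_p}} :=
  [set f : {ffun gT -> 'F_p} |
    [forall x, forall y, f (x * y)%g == f x + f y]]%SET.

Lemma hom_FpP (f : {ffun gT -> 'F_p}) :
  reflect {morph f : x y / (x * y)%g >-> x + y} (f \in hom_Fp).
Proof.
rewrite inE; apply: (iffP forallP) => [fM x y | fM x].
  exact/eqP/(forallP (fM x)).
by apply/forallP => y; rewrite fM.
Qed.

Hypotheses (p_pr : prime p) (pG : (p.-group [set: gT]%SET)%g).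
Local Notation G := [set: gT]%G.

(** The Frattini subgroup of a [p]-group is the join of [G'] and the subgroup of [p]-th powers. As
    [G'] is normal, the join is the set product. *)
Lemma der_mul_power_subgroup : (G^`(1) * power_subgroup p G = 'Phi(G))%g.
Proof.
rewrite (Phi_joing pG) (MhoE 1 pG) expn1 -norm_joinEr //.
by rewrite (fintype.subset_trans (finset.subsetT _)) // gFnorm.
Qed.

Section Hom.
Variable f : gT -> 'F_p.
Hypothesis fM : {morph f : x y / (x * y)%g >-> x + y}.

Lemma hom_Fp1 : f 1%g = 0.
Proof. by apply: (addrI (f 1%g)); rewrite -fM mulg1 addr0. Qed.

Lemma hom_FpV x : f x^-1%g = - f x.
Proof. by apply/eqP; rewrite -addr_eq0 -fM mulVg hom_Fp1. Qed.

Lemma hom_FpX x n : f (x ^+ n)%g = f x *+ n.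
Proof.
by elim: n => [|n IHn]; rewrite ?expg0 ?hom_Fp1 // expgS fM IHn mulrS.
Qed.

Fact ker_hom_group_set : group_set [set x | f x == 0]%SET.
Proof.
apply/group_setP; split=> [|x y]; rewrite !inE ?hom_Fp1 //.
by move=> /eqP fx /eqP fy; rewrite fM fx fy addr0.
Qed.
Canonical ker_hom_group := group ker_hom_group_set.

(** Commutators die because ['F_p] is commutative under addition, [p]-th powers because it has
    characteristic [p]. *)
Lemma Phi_ker_hom x : x \in 'Phi(G)%g -> f x = 0.
Proof.
move=> xPhi.
suffices /fintype.subsetP/(_ x xPhi) : ('Phi(G) \subset ker_hom_group)%g.
  by rewrite inE => /eqP.
rewrite (Phi_joing pG) (MhoE 1 pG) join_subG !gen_subG; apply/andP; split.
  apply/fintype.subsetP=> _ /imset2P[y z _ _ ->]; rewrite inE !fM !hom_FpV.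
  by rewrite (addrC (f y)) addKr addNr.
apply/fintype.subsetP=> _ /imsetP[y _ ->]; rewrite inE hom_FpX expn1.
by rewrite -mulr_natl pchar_Fp_0 // mul0r.
Qed.

End Hom.

(** Homomorphisms to ['F_p] factor through the vector space [G / 'Phi(G)], so they form its dual,
    which has as many elements as the space. Column vectors stand for linear forms. *)
Lemma card_hom_Fp : (1 < #|G|)%N -> #|hom_Fp| = #|(G / 'Phi(G))%g|.
Proof.
move=> G_gt1.
have abE : (p.-abelem (G / 'Phi(G)))%g by exact: Phi_quotient_abelem.
have ntG : G :!=: 1%g by rewrite -cardG_gt1.
have ntE : (G / 'Phi(G) != 1)%g.
  rewrite -subG1 quotient_sub1 ?gFnorm //; apply/negP => sG.
  by have := Phi_proper ntG; rewrite properE sG andbF.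
pose rV := abelem_rV abE ntE.
pose F (c : 'cV['F_p]_('dim (G / 'Phi(G)))) : {ffun gT -> 'F_p} :=
  [ffun x => (rV (coset 'Phi(G) x) *m c) 0 0].
have nPhi x : x \in 'N('Phi(G))%g.
  by apply: (fintype.subsetP (gFnorm _ _)); rewrite inE.
have mE x : coset 'Phi(G) x \in (G / 'Phi(G))%g.
  by rewrite mem_quotient ?inE.
have liftP v : exists x, rV (coset 'Phi(G) x) = v.
  have := mem_rVabelem abE ntE v; case/morphimP => x _ _ ex.
  by exists x; rewrite /rV -ex rVabelemK.
have rVM x y : rV (coset 'Phi(G) (x * y)%g)
    = rV (coset 'Phi(G) x) + rV (coset 'Phi(G) y).
  by rewrite morphM ?nPhi // /rV abelem_rV_M ?mE.
have F_inj : injective F.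
  move=> c d /ffunP eFcd; apply/matrixP => i j; rewrite ord1.
  have [x ex] := liftP (delta_mx 0 i).
  by have := eFcd x; rewrite !ffunE ex -!rowE !mxE.
have phi_rV (f : gT -> 'F_p) x y : {morph f : x y / (x * y)%g >-> x + y} ->
    rV (coset 'Phi(G) x) = rV (coset 'Phi(G) y) -> f x = f y :> 'F_p.
  move=> fM /(abelem_rV_inj (mE x) (mE y)).
  case/kercoset_rcoset=> // z zPhi ->.
  by rewrite fM (Phi_ker_hom fM zPhi) add0r.
have imF : F @: finset.setT = hom_Fp.
  apply/finset.setP => f; apply/imsetP/hom_FpP => [[c _ ->] x y | fM].
    by rewrite !ffunE rVM mulmxDl mxE.
  (* [r] is only a set-theoretic section of the coordinate map; by [phi_rV] the function [psi] is
     nevertheless additive. *)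
  have [r rE] := boolp.choice liftP.
  pose psi v := f (r v).
  have psiD : {morph psi : u v / u + v}.
    by move=> u v; rewrite -fM; apply: phi_rV => //; rewrite rVM !rE.
  have psi0 : psi 0 = 0 by apply: (addrI (psi 0)); rewrite -psiD !addr0.
  have psiMn v n : psi (v *+ n) = psi v *+ n.
    by elim: n => [|n IHn]; rewrite ?mulr0n // !mulrS psiD IHn.
  exists (\col_i psi (delta_mx 0 i)) => //; apply/ffunP => x; rewrite ffunE.
  have -> : f x = psi (rV (coset 'Phi(G) x)) by apply: phi_rV; rewrite ?rE.
  rewrite mxE [in LHS](row_sum_delta (rV _)) (big_morph psi psiD psi0).
  apply: eq_bigr => i _; rewrite mxE.
  (* Every scalar in ['F_p] is a natural multiple of 1, so additivity of [psi] gives linearity. *)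
  set a := rV _ _ _; rewrite -[a]natr_Zp scaler_nat psiMn.
  by rewrite mulr_natl.
rewrite -imF card_imset // cardsT -(card_abelem_rV abE ntE) !card_mx.
by rewrite mul1n muln1.
Qed.

(** Each fibre is empty or a coset of the kernel, whose order is divisible by [p] once [|G|] is at
    least [p^2]; so every fibre contributes 0. *)
Lemma sum_hom_Fp (f : gT -> 'F_p) : {morph f : x y / (x * y)%g >-> x + y} ->
  (p ^ 2 <= #|G|)%N -> \sum_x f x = 0.
Proof.
move=> fM oG; pose K := ker_hom_group fM.
have fiberE t : #|[set x | f x == t]%SET| = 0%N \/
    #|[set x | f x == t]%SET| = #|K|.
  have [y /eqP fy | no_y] := pickP (fun x => f x == t); [right | left].
    rewrite -(card_rcoset K y); apply: eq_card => x.
    by rewrite mem_rcoset !inE fM hom_FpV // fy subr_eq0.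
  by apply: eq_card0 => x; rewrite inE no_y.
(* The [p] fibres cover [G] and have at most [|K|] elements each, so [p^2 <= |G| <= p |K|]. *)
have oK : (p <= #|K|)%N.
  rewrite -(leq_pmul2l (prime_gt0 p_pr)) mulnn.
  apply: leq_trans oG _; rewrite -sum1_card (partition_big f predT) //=.
  apply: (@leq_trans (\sum_(t : 'F_p) #|K|)); last first.
    by rewrite sum_nat_const card_Fp.
  apply: leq_sum => t _; rewrite sum1dep_card.
  rewrite (_ : finset _ = [set x | f x == t]%SET); last first.
    by apply/finset.setP => x; rewrite !inE.
  by have [->|->] := fiberE t.
have pK : (p %| #|K|)%N.
  have /p_natP[[|m] em] : (p.-nat #|K|)%N.
  - exact: pgroupS (finset.subsetT _) pG.
  - by move: oK; rewrite em leqNgt prime_gt1.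
  - by rewrite em dvdn_exp.
rewrite (partition_big f predT) //= big1 // => t _.
rewrite (eq_bigr (fun=> t)) => [|x /eqP //].
rewrite sumr_const -cardsE -mulr_natl.
have [->|->] := fiberE t; first by rewrite mul0r.
by case/dvdnP: pK => m ->; rewrite natrM pchar_Fp_0 // mulr0 mul0r.
Qed.

(** * Left translations and annihilators over ['F_p] *)

Local Notation rVG := 'rV['F_p]_#|gT|.

(** Functions on [G] are coded as row vectors: these form a finite additive group, to which
    Lagrange's theorem applies below. *)
Definition ltrans (u : rVG) (x : gT) : rVG :=
  \row_i u 0 (enum_rank (x * enum_val i)%g).

Fact ltrans_is_action : is_action [set: gT]%SET ltrans.
Proof.
apply: is_total_action => [u | u x y]; apply/rowP => i; rewrite !mxE.
  by rewrite mul1g enum_valK.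
by rewrite enum_rankK mulgA.
Qed.
Canonical ltrans_action := Action ltrans_is_action.

(** The functions annihilating [a] form a [p]-group [S] stable under translation. A fixed point is a
    constant [c] with [c * \sum_g a g = 0], hence 0. So [|S|] is a power of [p] congruent to 1
    modulo [p], that is, 1. *)
Lemma conv_Fp_inj (a f : gT -> 'F_p) : \sum_g a g != 0 ->
  (forall g, \sum_h f h * a (h^-1 * g)%g = 0) -> forall h, f h = 0.
Proof.
move=> a_neq0 fa0.
pose S := [set u : rVG |
  [forall g, \sum_h u 0 (enum_rank h) * a (h^-1 * g)%g == 0]]%SET.
have SP (u : rVG) : reflect
    (forall g, \sum_h u 0 (enum_rank h) * a (h^-1 * g)%g = 0) (u \in S).
  by rewrite inE; apply: (iffP forallP) => ua g; apply/eqP.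
have S_group : group_set S.
  apply/group_setP; split=> [|u v /SP uS /SP vS].
    by apply/SP => g; rewrite big1 // => h _; rewrite mxE mul0r.
  apply/SP => g; under eq_bigr do rewrite mxE mulrDl.
  by rewrite big_split /= uS vS addr0.
have actS : [acts G, on S | ltrans_action].
  apply/fintype.subsetP => x _; rewrite !inE /=.
  apply/fintype.subsetP => u /SP uS; rewrite inE; apply/SP => g.
  rewrite (reindex_inj (mulgI x^-1%g)) /= -[RHS](uS (x * g)%g).
  apply: eq_bigr => h _.
  by rewrite mxE enum_rankK mulKVg invMg invgK mulgA.
have fixS : #|'Fix_(S | ltrans_action)(G)%g| = 1%N.
  apply/eqP/cards1P; exists 0; apply/finset.setP => u.
  rewrite finset.in_setI finset.in_set1.
  apply/andP/eqP => [[/SP uS /afixP uG] | ->]; last first.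
    split; first by case/group_setP: S_group.
    by apply/afixP => x _; apply/rowP => i; rewrite !mxE.
  have uE x : u 0 (enum_rank x) = u 0 (enum_rank 1%g).
    have /rowP/(_ (enum_rank 1%g)) := uG x (finset.in_setT x).
    by rewrite mxE enum_rankK mulg1.
  have /eqP := uS 1%g; under eq_bigr do rewrite uE mulg1.
  rewrite -mulr_sumr (reindex_inj invg_inj) /=.
  under eq_bigr do rewrite invgK.
  rewrite mulf_eq0 (negPf a_neq0) orbF => /eqP u1.
  by apply/rowP => i; rewrite -(enum_valK i) uE u1 mxE.
have := pgroup_fix_mod pG actS; rewrite fixS.
have pS : (p.-nat #|S|)%N.
  have SsubT : Group S_group \subset [set: rVG]%G by exact: finset.subsetT.
  have /pnat_dvd -> // := cardSg SsubT.
  by rewrite cardsT card_mx card_Fp // pnatX pnat_id.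
have /p_natP[[|m] oS] := pS; last first.
  by rewrite oS expnS modnMr modn_small ?prime_gt1.
have /eqP/cards1P[z eS] : #|S| = 1%N by [].
have inS (u : rVG) : u \in S -> u = z by rewrite eS => /set1P.
have z0 : z = 0 by rewrite -(inS 0) //; case/group_setP: S_group.
move=> _ h; have /inS/rowP/(_ (enum_rank h)) : \row_i f (enum_val i) \in S.
  apply/SP => g; rewrite -[RHS](fa0 g); apply: eq_bigr => x _.
  by rewrite mxE enum_rankK.
by rewrite z0 !mxE enum_rankK.
Qed.

End HomFp.

(** * Reduction modulo p *)

Section PadicReduction.
Variables (p : nat) (p_pr : prime p).
Local Notation Zp := (padic_int p_pr).

(** The modulus is [pdiv p] because ['F_p] unfolds to ['Z_(pdiv p)]. *)
Definition red (x : Zp) : 'F_p := Zp_red (pdiv p) (residue x 0).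

Fact pdiv_gt1 : (1 < pdiv p)%N.
Proof. by rewrite pdiv_id ?prime_gt1. Qed.
Fact pdiv_dvdX : (pdiv p %| p ^ 1)%N.
Proof. by rewrite pdiv_id. Qed.

Fact red_is_zmod_morphism : zmod_morphism red.
Proof.
move=> x y; rewrite /red /= (Zp_redD (pX_gt1 p_pr 0) pdiv_gt1 pdiv_dvdX).
by rewrite (Zp_redN (pX_gt1 p_pr 0) pdiv_gt1 pdiv_dvdX).
Qed.

Fact red_is_monoid_morphism : monoid_morphism red.
Proof.
split=> [|x y]; rewrite /red /=.
  by rewrite (Zp_red1 (pX_gt1 p_pr 0) pdiv_gt1 pdiv_dvdX).
by rewrite (Zp_redM (pX_gt1 p_pr 0) pdiv_gt1 pdiv_dvdX).
Qed.

HB.instance Definition _ :=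
  GRing.isZmodMorphism.Build Zp 'F_p red red_is_zmod_morphism.
HB.instance Definition _ :=
  GRing.isMonoidMorphism.Build Zp 'F_p red red_is_monoid_morphism.

Definition Fp_lift (t : 'F_p) : Zp := (t : nat)%:R.

Lemma Fp_liftK : cancel Fp_lift red.
Proof. by move=> t; rewrite rmorph_nat natr_Zp. Qed.

Lemma residue_nat m n : residue (m%:R : Zp) n = m%:R.
Proof. by elim: m => [|m IHm] //; rewrite -!natr1 /= IHm. Qed.

Lemma residue_eqmod (x : Zp) n :
  (residue x n.+1 = residue x n %[mod p ^ n.+1])%N.
Proof. by have := residue_mod x n 1; rewrite addn1. Qed.

Lemma residue_modp (x : Zp) n : (residue x n = residue x 0 %[mod p])%N.
Proof. exact: (residue_mod x 0 n). Qed.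

Lemma natr_Zp_mod m (k l : nat) : (1 < m)%N ->
  (k = l %[mod m])%N -> k%:R = l%:R :> 'Z_m.
Proof. by move=> m_gt1 ekl; apply: val_inj; rewrite /= !val_Zp_nat. Qed.

Lemma red_eq0 (x : Zp) : red x = 0 -> exists y, x = p%:R * y.
Proof.
move=> red0.
have px n : (p %| residue x n)%N.
  have : (residue x 0 = 0 %[mod p])%N.
    move/(congr1 val): red0; rewrite /red /Zp_red /= val_Zp_nat ?pdiv_gt1 //.
    by rewrite pdiv_id // mod0n.
  by rewrite -(residue_modp x n) mod0n => /eqP.
(* Dividing by [p] costs one digit, so level [n] of the quotient is read off level [n.+1] of [x]. *)
pose y n : 'Z_(p ^ n.+1) := (residue x n.+1 %/ p)%N%:R.
have yP n : Zp_red (p ^ n.+1) (y n.+1) = y n.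
  rewrite /y (Zp_red_nat (pX_gt1 p_pr _) (pX_gt1 p_pr _) (pX_dvd p _)).
  apply: natr_Zp_mod; first exact: pX_gt1.
  apply/eqP; rewrite -(eqn_pmul2l (prime_gt0 p_pr)) !muln_modr -expnS.
  rewrite ![(p * (_ %/ p))%N]mulnC !divnK //; apply/eqP.
  exact: residue_eqmod.
exists (PadicInt p_pr yP); apply: padic_intP => n /=.
rewrite residue_nat /y -natrM mulnC divnK // -[LHS]natr_Zp.
apply: natr_Zp_mod; first exact: pX_gt1.
exact/esym/residue_eqmod.
Qed.

Lemma red_eqP (x y : Zp) : red x = red y -> exists z, x = y + p%:R * z.
Proof.
move=> exy; case: (@red_eq0 (x - y)) => [|z ez].
  by rewrite rmorphB /= exy subrr.
by exists z; rewrite -ez addrC subrK.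
Qed.

Lemma red_p : red p%:R = 0.
Proof. by rewrite rmorph_nat pchar_Fp_0. Qed.

Lemma red_pM y : red (p%:R * y) = 0.
Proof. by rewrite rmorphM /= red_p mul0r. Qed.

(** All residues are prime to [p], hence invertible; their inverses are compatible because inverses
    are unique. *)
Lemma red_unit (x : Zp) : red x != 0 -> x \is a GRing.unit.
Proof.
move=> red_x.
have xU n : residue x n \is a GRing.unit.
  rewrite -[residue x n]natr_Zp unitZpE ?pX_gt1 //.
  rewrite coprimeXl // prime_coprime // /dvdn residue_modp.
  apply: contra red_x => px; apply/eqP/val_inj.
  rewrite /red /Zp_red /= val_Zp_nat ?pdiv_gt1 // pdiv_id //.
  exact/eqP.
pose y n := (residue x n)^-1.
have yP n : Zp_red (p ^ n.+1) (y n.+1) = y n.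
  apply: (mulrI (xU n)); rewrite (divrr (xU n)).
  have redM := @Zp_redM _ _ (pX_gt1 p_pr n.+1) (pX_gt1 p_pr n) (pX_dvd p n).
  rewrite -{1}(residueP x n) -redM (divrr (xU n.+1)).
  exact: (Zp_red1 (pX_gt1 p_pr n.+1) (pX_gt1 p_pr n) (pX_dvd p n)).
apply/unitrP; exists (PadicInt p_pr yP).
by split; apply: padic_intP => n /=; rewrite ?(divrr (xU n)) ?(mulVr (xU n)).
Qed.

Lemma p_neq0 : p%:R != 0 :> Zp.
Proof.
(* Index 1 means modulo [p^2], the first level at which [p] does not vanish. *)
apply/eqP => /(congr1 (fun x : Zp => residue x 1)); rewrite residue_nat /=.
move/(congr1 val); rewrite /= val_Zp_nat ?pX_gt1 // modn_small.
  by apply/eqP; rewrite -lt0n prime_gt0.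
by rewrite -{1}(expn1 p) ltn_exp2l ?prime_gt1.
Qed.

Variable gT : finGroupType.
Hypothesis pG : (p.-group [set: gT]%SET)%g.

(** Convolution with [a] is the matrix [M] acting on row vectors. Its reduction has zero kernel by
    [conv_Fp_inj], so [\det M] is a unit modulo [p], hence in [Zp]. The left inverse is the row of
    [invmx M] at the identity. *)
Lemma conv_left_inverse (a : gT -> Zp) : red (\sum_g a g) != 0 ->
  exists b : gT -> Zp,
    forall g, \sum_h b h * a (h^-1 * g)%g = (g == 1%g)%:R.
Proof.
move=> red_a.
pose M : 'M[Zp]_#|gT| := \matrix_(i, j) a ((enum_val i)^-1 * enum_val j)%g.
have Mu : M \in unitmx.
  rewrite unitmxE; apply: red_unit; rewrite -det_map_mx -unitfE -unitmxE.
  rewrite -row_free_unit -kermx_eq0; apply/eqP/row_matrixP => k.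
  set v := row k _; rewrite row0.
  have vM : v *m map_mx red M = 0 by rewrite -row_mul mulmx_ker row0.
  apply/rowP => i; rewrite [RHS]mxE -(enum_valK i).
  apply: (conv_Fp_inj p_pr pG (a := red \o a) (f := v 0 \o enum_rank)).
    by rewrite -rmorph_sum.
  move=> g; transitivity ((v *m map_mx red M) 0 (enum_rank g)); last first.
    by rewrite vM mxE.
  rewrite mxE [RHS](reindex _ (onW_bij _ (enum_rank_bij gT))) /=.
  by apply: eq_bigr => h _; rewrite !mxE !enum_rankK.
pose u : 'rV[Zp]_#|gT| := delta_mx 0 (enum_rank 1%g) *m invmx M.
have /rowP uM : u *m M = delta_mx 0 (enum_rank 1%g) by rewrite mulmxKV.
exists (fun h => u 0 (enum_rank h)) => g.
transitivity ((u *m M) 0 (enum_rank g)); last first.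
  by rewrite uM mxE eqxx (inj_eq enum_rank_inj).
rewrite mxE [RHS](reindex _ (onW_bij _ (enum_rank_bij gT))) /=.
by apply: eq_bigr => h _; rewrite !mxE !enum_rankK.
Qed.

End PadicReduction.

Local Open Scope classical_set_scope.
Local Open Scope card_scope.

(** * Local rings and transversals *)

Section SubsetsOfARing.
Variable A : nzRingType.

(** A left ideal containing an element outside [m] contains 1. So every proper left ideal lies in
    [m], which is then the only maximal one. *)
Lemma jacobson_radical_local (R m : set A) :
    left_ideal R m -> R 1 -> ~ m 1 ->
    (forall x, R x -> ~ m x -> exists2 y, R y & y * x = 1) ->
  jacobson_radical R = m.
Proof.
move=> mI R1 m1 invR; have [mR m0 mB mM] := mI.
have sub_m I : left_ideal R I -> I <> R -> I `<=` m.
  move=> [IR _ _ IM] IneR x Ix; apply: contrapT => mx; apply: IneR.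
  have [y Ry yx1] := invR x (IR x Ix) mx.
  apply/seteqP; split=> // r Rr.
  by rewrite -[r]mulr1 -yx1; apply: (IM) => //; apply: (IM).
have maxm : maximal_left_ideal R m.
  split=> // [emR | I II mI']; first by apply: m1; rewrite emR.
  have [->|IneR] := pselect (I = R); first by right.
  by left; apply/seteqP; split=> //; apply: sub_m.
apply/seteqP; split=> [x [_ /(_ m maxm)] // | x mx].
split=> [|I [II IneR Imax]]; first exact: mR.
case: (Imax m mI (sub_m I II IneR)) => em; first by rewrite -em.
by case: m1; rewrite em.
Qed.

(** Used for both indices: [f] lists a transversal, so [i] to [f i + L] is a bijection from [F] onto
    the cosets. *)
Lemma quotient_card_transversal (M L : set A) (F : finType) (f : F -> A) :
    L `<=` M -> L 0 -> (forall x y, L x -> L y -> L (x - y)) ->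
    (forall i, M (f i)) -> (forall x, M x -> exists i, L (x - f i)) ->
    (forall i j, L (f i - f j) -> i = j) ->
  quotient_card M L #|F|.
Proof.
move=> LM L0 LB Mf fM f_inj; split=> //.
have LN x : L x -> L (- x) by move=> Lx; rewrite -[- x]add0r; apply: LB.
have LD x y : L x -> L y -> L (x + y).
  by move=> Lx Ly; rewrite -[y]opprK; apply: LB => //; apply: LN.
have -> : [set [set x + y | y in L] | x in M]
        = [set [set f i + y | y in L] | i in [set: F]].
  apply/seteqP; split=> [_ [x Mx <-] | _ [i _ <-]]; last by exists (f i).
  have [i Li] := fM x Mx; exists i => //; apply/seteqP; split=> _ [y Ly <-].
    exists (y - (x - f i)); first exact: LB.
    by rewrite opprB addrCA subrKC addrC.
  exists (y + (x - f i)); first exact: LD.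
  by rewrite addrCA subrKC addrC.
pose coset i := [set f i + y | y in L].
have coset_inj : {in [set: F] &, injective coset}.
  move=> i j _ _ eij; apply: f_inj.
  have : coset j (f i) by rewrite -eij; exists 0; rewrite ?addr0.
  by case=> y Ly <-; rewrite addrAC subrr add0r.
apply: card_eq_trans (inj_card_eq coset_inj) _.
have rank_inj : {in [set: F] &, injective (fun i : F => enum_rank i : nat)}.
  by move=> i j _ _ /val_inj/enum_rank_inj.
rewrite card_eq_sym; apply: card_eq_trans (inj_card_eq rank_inj).
rewrite (_ : [set _ | _ in _] = `I_#|F|) //.
apply/seteqP; split=> [_ [i _ <-] | k /= kF]; first exact: ltn_ord.
by exists (enum_val (Ordinal kF)); rewrite ?enum_valK.
Qed.
End SubsetsOfARing.

(** * The group ring over the p-adic integers *)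

(* Stated over an abstract field: [field] does not terminate on [padic p_pr]. *)
Section FieldIdentities.
Variables (F : fieldType) (q : F).
Hypothesis q_neq0 : q != 0.

Lemma mulr_sqr_div k m : k * (q ^+ 2 * m) / q = q * k * m.
Proof. by field. Qed.

Lemma mulr_mul_div k x : k * x = q * k * (x / q).
Proof. by field. Qed.

(** This is the coefficient of [nrm] in [(1 + d/q nrm) (1 + c/q nrm)] when [nrm] has augmentation
    [q^2 m]. *)
Lemma quasi_inverse_sum c d m :
  c / q + (d / q + c / q * (d / q) * (q ^+ 2 * m))
  = (d + c + q * (c * d * m)) / q.
Proof. by field. Qed.

Lemma second_difference_div u v w z l :
  q^-1 * u + l - (q^-1 * v + l) - (q^-1 * w + l - (q^-1 * z + l))
  = (u - v - (w - z)) / q.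
Proof. by ring. Qed.
Lemma sqr_mul_div k : q ^+ 2 * k / q / q = k.
Proof. by field. Qed.

Lemma sqr_div_mul k : q ^+ 2 * (k / q / q) = k.
Proof. by field. Qed.

Lemma mul_carry u v : q * (u / q + v / q / q) = u + v / q.
Proof. by field. Qed.

Lemma carry_div b c z n :
  q^-1 * b + (c + q * z) / q / q - (q^-1 * n + c / q / q) = (b + z - n) / q.
Proof. by field. Qed.

Lemma regroup_div u v w x :
  q^-1 * u + v / q / q - (q^-1 * w + x / q / q) = (u - w) / q + (v - x) / q / q.
Proof. by field. Qed.
End FieldIdentities.

Section GroupRing.
Variables (p : nat) (p_pr : prime p) (gT : finGroupType).
Local Notation Zp := (padic_int p_pr).
Local Notation K := (padic p_pr).
Local Notation KG := (group_algebra K gT).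
Local Notation iota := (@FracField.tofrac Zp).
Local Notation pi := (iota p%:R).
Local Notation Lambda := (@integral_group_ring p p_pr gT).

(** * The [p]-adic integers inside their fraction field *)

Definition padic_integers : {pred K} :=
  fun k => `[< exists z : Zp, k = iota z >].

Lemma integralP k : reflect (exists z : Zp, k = iota z) (k \in padic_integers).
Proof. exact: asboolP. Qed.

Lemma tofrac_padic_integral z : iota z \in padic_integers.
Proof. by apply/integralP; exists z. Qed.

Fact padic_integral_subring_closed : subring_closed padic_integers.
Proof.
split=> [|k l|k l].
- by rewrite -tofrac1 tofrac_padic_integral.
- move=> /integralP[x ->] /integralP[y ->].
  by rewrite -tofracB tofrac_padic_integral.
- move=> /integralP[x ->] /integralP[y ->].
  by rewrite -tofracM tofrac_padic_integral.
Qed.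
HB.instance Definition _ :=
  GRing.isSubringClosed.Build K padic_integers padic_integral_subring_closed.

Lemma pi_neq0 : pi != 0 :> K.
Proof. by rewrite tofrac_eq0 p_neq0. Qed.

(** The bridge by which integrality conditions in [K] become equations in ['F_p]. *)
Lemma tofrac_div_pi z : (iota z / pi \in padic_integers) = (red z == 0).
Proof.
apply/integralP/eqP => [[y ey] | /red_eq0[y ->]].
  suff -> : z = p%:R * y by rewrite red_pM.
  apply/eqP; rewrite -tofrac_eq tofracM mulrC -ey divfK //.
  exact: pi_neq0.
by exists y; rewrite tofracM mulrAC divff ?pi_neq0 ?mul1r.
Qed.

(** * Augmentation and the sum of the group elements *)

Definition emb (b : gT -> Zp) : KG := [ffun g => iota (b g)].
Definition nrm : KG := [ffun=> 1].
Definition aug (a : KG) : K := \sum_g a g.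

Fact aug_is_zmod_morphism : zmod_morphism aug.
Proof.
by move=> a b; rewrite /aug -sumrB; apply: eq_bigr => g _; rewrite !ffunE.
Qed.
HB.instance Definition _ :=
  GRing.isZmodMorphism.Build KG K aug aug_is_zmod_morphism.

Lemma galgM_E (a b : KG) g : (a * b) g = \sum_h a h * b (h^-1 * g)%g.
Proof. by rewrite ffunE. Qed.

Lemma galgZ_E k (a : KG) g : (k *: a) g = k * a g.
Proof. by rewrite ffunE. Qed.

Lemma galgB_E (a b : KG) g : (a - b) g = a g - b g.
Proof. by rewrite !ffunE. Qed.

Lemma galgD_E (a b : KG) g : (a + b) g = a g + b g.
Proof. by rewrite ffunE. Qed.

Lemma nrm_E g : nrm g = 1.
Proof. by rewrite ffunE. Qed.

Lemma emb_E b g : emb b g = iota (b g).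
Proof. by rewrite ffunE. Qed.

Lemma augZ k a : aug (k *: a) = k * aug a.
Proof. by rewrite mulr_sumr; apply: eq_bigr => g _; rewrite galgZ_E. Qed.

Lemma mulr_nrm a : a * nrm = aug a *: nrm.
Proof.
apply/ffunP => g; rewrite galgM_E galgZ_E ffunE mulr1.
by apply: eq_bigr => h _; rewrite ffunE mulr1.
Qed.

Lemma nrm_mulr a : nrm * a = aug a *: nrm.
Proof.
apply/ffunP => g; rewrite galgM_E galgZ_E ffunE mulr1.
rewrite (reindex_inj invg_inj) (reindex_inj (mulIg g^-1%g)) /=.
by apply: eq_bigr => h _; rewrite ffunE mul1r invgK mulgKV.
Qed.

(** Elements act on the line spanned by [nrm] through their augmentation; computing [a * b * nrm] in
    two ways gives the claim. *)
Lemma augM a b : aug (a * b) = aug a * aug b.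
Proof.
have : aug (a * b) *: nrm = (aug a * aug b) *: nrm.
  by rewrite -mulr_nrm -mulrA mulr_nrm -scalerAr mulr_nrm scalerA mulrC.
by move/ffunP/(_ 1%g); rewrite !galgZ_E ffunE !mulr1.
Qed.

Lemma aug1 : aug 1 = 1.
Proof.
rewrite /aug (bigD1 1%g) //= big1 => [|g /negPf g1]; rewrite ffunE.
  by rewrite eqxx addr0.
by rewrite g1.
Qed.

Lemma aug_nrm : aug nrm = #|gT|%:R.
Proof.
rewrite /aug; under eq_bigr do rewrite ffunE.
by rewrite sumr_const.
Qed.

Lemma aug_emb b : aug (emb b) = iota (\sum_g b g).
Proof. by rewrite rmorph_sum; apply: eq_bigr => g _; rewrite ffunE. Qed.

Lemma embM b d : emb b * emb d = emb (fun g => \sum_h b h * d (h^-1 * g)%g).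
Proof.
apply/ffunP => g; rewrite galgM_E ffunE rmorph_sum /=.
by apply: eq_bigr => h _; rewrite !ffunE tofracM.
Qed.

(** * The integral group ring as a subring *)

Lemma LambdaP a : Lambda a <-> forall g, a g \in padic_integers.
Proof. by split=> La g; [apply/integralP/La | exact/integralP/La]. Qed.

Lemma Lambda_emb a : Lambda a <-> exists b, a = emb b.
Proof.
split=> [/boolp.choice[b ab] | [b ->] g]; last by exists (b g); rewrite ffunE.
by exists b; apply/ffunP => g; rewrite ffunE.
Qed.

Lemma emb_Lambda b : Lambda (emb b).
Proof. by apply/Lambda_emb; exists b. Qed.

Lemma Lambda0 : Lambda 0.
Proof. by apply/LambdaP => g; rewrite ffunE rpred0. Qed.

Lemma Lambda1 : Lambda 1.
Proof. by apply/LambdaP => g; rewrite ffunE rpred_nat. Qed.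

Lemma LambdaB a b : Lambda a -> Lambda b -> Lambda (a - b).
Proof.
by move=> /LambdaP La /LambdaP Lb; apply/LambdaP => g; rewrite !ffunE rpredB.
Qed.

Lemma LambdaD a b : Lambda a -> Lambda b -> Lambda (a + b).
Proof.
by move=> /LambdaP La /LambdaP Lb; apply/LambdaP => g; rewrite !ffunE rpredD.
Qed.

Lemma LambdaM a b : Lambda a -> Lambda b -> Lambda (a * b).
Proof.
move=> /LambdaP La /LambdaP Lb; apply/LambdaP => g.
by rewrite galgM_E rpred_sum // => h _; rewrite rpredM.
Qed.

Lemma LambdaZ k a : k \in padic_integers -> Lambda a -> Lambda (k *: a).
Proof.
by move=> Ok /LambdaP La; apply/LambdaP => g; rewrite galgZ_E rpredM.
Qed.

Lemma Lambda_nrm : Lambda nrm.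
Proof. by apply/LambdaP => g; rewrite ffunE rpred1. Qed.

Lemma aug_Lambda a : Lambda a -> aug a \in padic_integers.
Proof. by move/LambdaP => La; rewrite rpred_sum. Qed.

(** * Explicit forms of the radicals and idealizers *)

Definition rad_Lambda : set KG :=
  [set a | Lambda a /\ aug a / pi \in padic_integers].

(* [Lambda + Zp * (nrm / p)] *)
Definition Gamma_order : set KG :=
  [set a | pi * a 1%g \in padic_integers /\
    forall g, a g - a 1%g \in padic_integers].

Definition rad_Gamma : set KG :=
  [set a | Gamma_order a /\ aug a / pi \in padic_integers].

(** The pair [b], [k] is not unique: a multiple of [nrm / p] can be moved between the constant part
    of [b] and [k]. *)
Definition Delta_order : set KG :=
  [set a | exists b k, [/\ pi ^+ 2 * k \in padic_integers,
    exists s, exists2 f : gT -> 'F_p, {morph f : x y / (x * y)%g >-> x + y} &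
      forall h, red (b h) = s + f h &
    a = pi^-1 *: emb b + k *: nrm]].

Lemma GammaP a : Gamma_order a <->
  exists x k, [/\ Lambda x, pi * k \in padic_integers & a = x + k *: nrm].
Proof.
split=> [[a1 ag] | [x [k [/LambdaP Lx Ok ->]]]].
  exists (a - a 1%g *: nrm), (a 1%g); split=> //; last by rewrite subrK.
  by apply/LambdaP => g; rewrite !ffunE mulr1.
split=> [|g]; rewrite !ffunE mulr1.
  by rewrite mulrDr rpredD // rpredM // tofrac_padic_integral.
by rewrite opprD addrACA subrr addr0 rpredB.
Qed.

Lemma Lambda_Gamma : Lambda `<=` Gamma_order.
Proof.
by move=> a La; apply/GammaP; exists a, 0; rewrite mulr0 scale0r addr0 rpred0.
Qed.

Lemma GammaB a b : Gamma_order a -> Gamma_order b -> Gamma_order (a - b).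
Proof.
move=> [a1 ag] [b1 bg]; split=> [|g]; rewrite !ffunE.
  by rewrite mulrBr rpredB.
have -> : a g - b g - (a 1%g - b 1%g) = (a g - a 1%g) - (b g - b 1%g) by ring.
by rewrite rpredB.
Qed.

Lemma GammaD a b : Gamma_order a -> Gamma_order b -> Gamma_order (a + b).
Proof.
move=> Ga Gb; rewrite -[b]opprK; apply: (GammaB) => //.
rewrite -[- b]add0r; apply: (GammaB) => //.
exact/Lambda_Gamma/Lambda0.
Qed.

Lemma Gamma_nrm k : pi * k \in padic_integers -> Gamma_order (k *: nrm).
Proof.
move=> Ok; apply/GammaP; exists 0, k.
by split=> //; [exact: Lambda0 | rewrite add0r].
Qed.

(** * Locality of the two orders and their radicals *)

Hypotheses (pG : (p.-group [set: gT]%SET)%g).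
Hypothesis oG : (p ^ 2 <= #|[set: gT]%SET|)%N.

(** The bound on [|G|] enters here: [nrm / p] has augmentation divisible by [p], and [nrm / p^2]
    still has integral augmentation. *)
Lemma aug_nrmE : exists m : nat, aug nrm = pi ^+ 2 * m%:R.
Proof.
have /p_natP[n en] : (p.-nat #|[set: gT]%SET|)%N := pG.
have n_ge2 : (2 <= n)%N.
  by move: oG; rewrite en leq_exp2l // prime_gt1.
exists (p ^ (n - 2))%N; rewrite aug_nrm -cardsT en -[in LHS](subnKC n_ge2).
by rewrite expnD natrM natrX rmorph_nat.
Qed.

Lemma aug_Gamma a : Gamma_order a -> aug a \in padic_integers.
Proof.
case/GammaP => x [k [Lx Ok ->]]; rewrite raddfD /= augZ rpredD ?aug_Lambda //.
have [m ->] := aug_nrmE.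
have -> : k * (pi ^+ 2 * m%:R) = (pi * k) * (pi * m%:R) by ring.
by rewrite (rpredM Ok) // rpredM ?tofrac_padic_integral ?rpred_nat.
Qed.

Lemma GammaM a b : Gamma_order a -> Gamma_order b -> Gamma_order (a * b).
Proof.
move=> /GammaP[x [k [Lx Ok ->]]] Gb; rewrite mulrDl -scalerAl nrm_mulr scalerA.
apply: GammaD; last by apply: Gamma_nrm; rewrite mulrA rpredM ?aug_Gamma.
case/GammaP: Gb => y [l [Ly Ol ->]]; rewrite mulrDr -scalerAr mulr_nrm scalerA.
apply: GammaD; first exact/Lambda_Gamma/LambdaM.
by apply: Gamma_nrm; rewrite mulrA rpredM ?aug_Lambda.
Qed.

Lemma one_div_pi : 1 / pi \notin padic_integers.
Proof. by rewrite -tofrac1 tofrac_div_pi rmorph1 oner_eq0. Qed.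

Lemma Lambda_left_inverse a :
    Lambda a -> aug a / pi \notin padic_integers ->
  exists2 b, Lambda b & b * a = 1.
Proof.
case/Lambda_emb => d ->; rewrite aug_emb tofrac_div_pi => red_d.
have [b bd] := conv_left_inverse pG red_d.
exists (emb b); first exact: emb_Lambda.
apply/ffunP => g; rewrite embM !ffunE bd.
by case: (g == 1%g); rewrite ?tofrac1 ?tofrac0.
Qed.

(** Write [a = x + k nrm]. The second term has augmentation divisible by [p], so [x] has a left
    inverse [b] in [Lambda]. Then [b a = 1 + (c/p) nrm], which is inverted by an element
    [1 + (d/p) nrm]. *)
Lemma Gamma_left_inverse a :
    Gamma_order a -> aug a / pi \notin padic_integers ->
  exists2 b, Gamma_order b & b * a = 1.
Proof.
case/GammaP=> x [k [Lx Ok ->]] aug_a; have [m eN] := aug_nrmE.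
have [||b Lb bx] := @Lambda_left_inverse x => //.
  apply: contra aug_a => Ox; rewrite raddfD /= augZ mulrDl rpredD //.
  have -> : k * aug nrm / pi = pi * k * m%:R.
    by rewrite eN mulr_sqr_div ?pi_neq0.
  by rewrite rpredM ?rpred_nat.
have /integralP[c ec] : pi * (k * aug b) \in padic_integers.
  by rewrite mulrA rpredM ?aug_Lambda.
have ek : k * aug b = iota c / pi by rewrite -ec mulrAC divff ?mul1r ?pi_neq0.
(* The equation for [d] is [d + c + p c d m = 0], that is [d u = - c], with [u] congruent to 1
   modulo [p]. *)
pose u : Zp := 1 + p%:R * (c * m%:R).
have uU : u \is a GRing.unit.
  by apply: red_unit; rewrite rmorphD rmorph1 /= red_pM addr0 oner_eq0.
pose d := - c / u.
have du : d + c + p%:R * (c * d * m%:R) = 0.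
  have -> : d + c + p%:R * (c * d * m%:R) = d * u + c by rewrite /u; ring.
  by rewrite divrK // addNr.
have bE : b * (x + k *: nrm) = 1 + (iota c / pi) *: nrm.
  by rewrite mulrDr bx -scalerAr mulr_nrm scalerA ek.
have Gd : Gamma_order (1 + (iota d / pi) *: nrm).
  apply: GammaD; first exact/Lambda_Gamma/Lambda1.
  by apply: Gamma_nrm; rewrite mulrC divfK ?pi_neq0 // tofrac_padic_integral.
exists ((1 + (iota d / pi) *: nrm) * b).
  by apply: GammaM => //; exact: Lambda_Gamma.
rewrite -mulrA bE mulrDl mul1r mulrDr mulr1 -scalerAr -scalerAl nrm_mulr.
rewrite !scalerA -addrA -!scalerDl eN.
rewrite quasi_inverse_sum ?pi_neq0 //.
have -> : iota d + iota c + pi * (iota c * iota d * m%:R)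
    = iota (d + c + p%:R * (c * d * m%:R)).
  by rewrite !(tofracD, tofracM) !rmorph_nat.
by rewrite du tofrac0 mul0r scale0r addr0.
Qed.

Lemma rad_Lambda_ideal : left_ideal Lambda rad_Lambda.
Proof.
split=> [a [] // | | a b [La Oa] [Lb Ob] | r a Lr [La Oa]].
- by split; [exact: Lambda0 | rewrite raddf0 mul0r rpred0].
- by split; [exact: LambdaB | rewrite raddfB mulrBl rpredB].
- by split; [exact: LambdaM | rewrite augM -mulrA rpredM ?aug_Lambda].
Qed.

Lemma rad_Gamma_ideal : left_ideal Gamma_order rad_Gamma.
Proof.
split=> [a [] // | | a b [La Oa] [Lb Ob] | r a Lr [La Oa]].
- split; last by rewrite raddf0 mul0r rpred0.
  exact/Lambda_Gamma/Lambda0.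
- by split; [exact: GammaB | rewrite raddfB mulrBl rpredB].
- by split; [exact: GammaM | rewrite augM -mulrA rpredM ?aug_Gamma].
Qed.

Lemma jacobson_radical_Lambda : jacobson_radical Lambda = rad_Lambda.
Proof.
apply: jacobson_radical_local => [||[_]|a La JLa].
- exact: rad_Lambda_ideal.
- exact: Lambda1.
- by rewrite aug1 (negPf one_div_pi).
- by apply: Lambda_left_inverse => //; apply/negP => Oa; apply: JLa.
Qed.

Lemma jacobson_radical_Gamma : jacobson_radical Gamma_order = rad_Gamma.
Proof.
apply: jacobson_radical_local => [||[_]|a Ga JGa].
- exact: rad_Gamma_ideal.
- exact/Lambda_Gamma/Lambda1.
- by rewrite aug1 (negPf one_div_pi).
- by apply: Gamma_left_inverse => //; apply/negP => Oa; apply: JGa.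
Qed.

(** * Idealizers of the two radicals *)

Definition galg_delta (x : gT) : KG := emb (fun g => (g == x)%:R).

Lemma mulr_galg_delta a x g : (a * galg_delta x) g = a (g * x^-1)%g.
Proof.
rewrite galgM_E (bigD1 (g * x^-1)%g) //= big1 => [|h hg].
  by rewrite !ffunE invMg invgK mulgKV eqxx tofrac1 mulr1 addr0.
rewrite !ffunE; case: eqP => [ex|]; last by rewrite tofrac0 mulr0.
by case/eqP: hg; rewrite -ex invMg invgK mulKVg.
Qed.

Lemma aug_galg_delta x : aug (galg_delta x) = 1.
Proof.
rewrite aug_emb (bigD1 x) //= eqxx big1 => [|g /negPf -> //].
by rewrite addr0 tofrac1.
Qed.

Lemma rad_Lambda_pi : rad_Lambda (pi *: 1).
Proof.
split; last by rewrite augZ aug1 mulr1 divff ?pi_neq0 ?rpred1.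
by apply: LambdaZ; [exact: tofrac_padic_integral | exact: Lambda1].
Qed.

Lemma rad_Lambda_delta x : rad_Lambda (galg_delta x - 1).
Proof.
split; last by rewrite raddfB /= aug_galg_delta aug1 subrr mul0r rpred0.
by apply: LambdaB; [exact: emb_Lambda | exact: Lambda1].
Qed.

Lemma rad_Lambda_sub_Gamma : rad_Lambda `<=` rad_Gamma.
Proof. by move=> a [/Lambda_Gamma Ga Oa]. Qed.

(** Testing on [p] bounds the denominators; testing on [g^-1 - 1] and reading the coefficient at 1
    gives [a g - a 1]. Conversely, [nrm] times [y] is [aug y] times [nrm], and [aug y] absorbs the
    denominator [p]. *)
Lemma Idealizer_rad_Lambda : Idealizer rad_Lambda = Gamma_order.
Proof.
apply/seteqP; split=> [a [aJ _] | a Ga].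
  have [/LambdaP La _] := aJ _ rad_Lambda_pi.
  split=> [|g]; first by have := La 1%g; rewrite -scalerAr mulr1 galgZ_E.
  have [/LambdaP/(_ 1%g) Lg _] := aJ _ (rad_Lambda_delta g^-1).
  move: Lg; rewrite mulrBr mulr1.
  by rewrite galgB_E mulr_galg_delta invgK mul1g.
have augJ y : rad_Lambda y -> aug a * aug y / pi \in padic_integers.
  by move=> [_ Oy]; rewrite -mulrA rpredM ?aug_Gamma.
have [x [k [Lx Ok ea]]] := (GammaP a).1 Ga.
have OkM y : rad_Lambda y -> k * aug y \in padic_integers.
  by case=> _ Oy; rewrite (mulr_mul_div pi_neq0) rpredM.
split=> y Jy; (split; last by rewrite augM 1?[aug y * _]mulrC augJ).
  rewrite ea mulrDl -scalerAl nrm_mulr scalerA.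
  case: (Jy) => Ly _; apply: LambdaD; first exact: LambdaM.
  by apply: LambdaZ; [exact: OkM | exact: Lambda_nrm].
rewrite ea mulrDr -scalerAr mulr_nrm scalerA.
case: (Jy) => Ly _; apply: LambdaD; first exact: LambdaM.
by apply: LambdaZ; [exact: OkM | exact: Lambda_nrm].
Qed.

Lemma red_sum_affine (b : gT -> Zp) s (f : gT -> 'F_p) :
    {morph f : x y / (x * y)%g >-> x + y} -> (forall h, red (b h) = s + f h) ->
  red (\sum_h b h) = 0.
Proof.
move=> fM bE; rewrite rmorph_sum /=; under eq_bigr do rewrite bE.
rewrite big_split /= (sum_hom_Fp p_pr pG fM oG) addr0 sumr_const -mulr_natl.
have -> : #|gT|%:R = 0 :> 'F_p; last by rewrite mul0r.
apply/eqP; rewrite -(dvdn_pcharf (pchar_Fp p_pr)) -cardsT.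
have /p_natP[[|n] en] : (p.-nat #|[set: gT]%SET|)%N := pG.
  by move: oG; rewrite en leqNgt (ltn_exp2l 0) ?prime_gt1.
by rewrite en dvdn_exp.
Qed.

(** As [f (g h^-1) = f g - f h] and [d] has augmentation 0 modulo [p], the terms in [s] and [f g]
    drop out, leaving a sum independent of [g]. *)
Lemma red_conv_affine_l (b d : gT -> Zp) s (f : gT -> 'F_p) :
    {morph f : x y / (x * y)%g >-> x + y} -> (forall h, red (b h) = s + f h) ->
    red (\sum_h d h) = 0 ->
  forall g, red (\sum_h b h * d (h^-1 * g)%g)
    = red (\sum_h b h * d (h^-1 * 1)%g).
Proof.
move=> fM bE; rewrite rmorph_sum /= => d0.
suff E g : red (\sum_h b h * d (h^-1 * g)%g)
    = - \sum_h f h * red (d h) by move=> g; rewrite !E.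
rewrite (reindex_inj invg_inj) (reindex_inj (mulIg g^-1%g)) /= rmorph_sum /=.
transitivity (\sum_h ((s + f g) * red (d h) - f h * red (d h))); last first.
  by rewrite sumrB -mulr_sumr d0 mulr0 sub0r.
apply: eq_bigr => h _; rewrite rmorphM /= invgK mulgKV bE.
rewrite invMg invgK fM hom_FpV //; ring.
Qed.

Lemma red_conv_affine_r (b d : gT -> Zp) s (f : gT -> 'F_p) :
    {morph f : x y / (x * y)%g >-> x + y} -> (forall h, red (b h) = s + f h) ->
    red (\sum_h d h) = 0 ->
  forall g, red (\sum_h d h * b (h^-1 * g)%g)
    = red (\sum_h d h * b (h^-1 * 1)%g).
Proof.
move=> fM bE; rewrite rmorph_sum /= => d0.
suff E g : red (\sum_h d h * b (h^-1 * g)%g)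
    = - \sum_h red (d h) * f h by move=> g; rewrite !E.
rewrite rmorph_sum /=.
transitivity (\sum_h ((s + f g) * red (d h) - red (d h) * f h)); last first.
  by rewrite sumrB -mulr_sumr d0 mulr0 sub0r.
apply: eq_bigr => h _; rewrite rmorphM /= bE fM hom_FpV //; ring.
Qed.

Lemma Gamma_emb_div e : (forall g, red (e g) = red (e 1%g)) ->
  Gamma_order (pi^-1 *: emb e).
Proof.
move=> eE; split=> [|g]; rewrite !galgZ_E !emb_E.
  by rewrite mulrA divff ?pi_neq0 // mul1r tofrac_padic_integral.
by rewrite -mulrBr mulrC -tofracB tofrac_div_pi rmorphB /= eE subrr.
Qed.

Lemma aug_div_pi x k : pi * k \in padic_integers ->
  aug (x + k *: nrm) / pi \in padic_integers -> aug x / pi \in padic_integers.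
Proof.
move=> Ok; rewrite raddfD /= augZ mulrDl; have [m ->] := aug_nrmE.
by rewrite mulr_sqr_div ?pi_neq0 // rpredDr // rpredM ?rpred_nat.
Qed.

(** Testing on [p] yields the shape [p^-1 b + k nrm], testing on [g^-1 - 1] the affine reduction of
    [b]. Conversely, affine functions convolve the radical into functions constant modulo [p]. *)
Lemma Idealizer_rad_Gamma : Idealizer rad_Gamma = Delta_order.
Proof.
apply/seteqP; split=> [a [aJ _] | a [b [k [Ok [s [f fM bE]] ea]]]].
  have [Gpa _] := aJ _ (rad_Lambda_sub_Gamma rad_Lambda_pi).
  case/GammaP: Gpa => _ [l [/Lambda_emb[b ->] Ol]].
  rewrite -scalerAr mulr1 => /(congr1 ( *:%R pi^-1)).
  rewrite scalerA mulVf ?pi_neq0 // scale1r scalerDr scalerA => ea.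
  have aE h : a h = pi^-1 * iota (b h) + pi^-1 * l.
    by rewrite ea galgD_E galgZ_E galgZ_E emb_E nrm_E mulr1.
  (* Compare the coefficients of [a (g^-1 - 1)] at [h] and at 1; the multiples of [nrm] cancel. *)
  have fE g h : red (b (h * g)%g) - red (b h) - (red (b g) - red (b 1%g)) = 0.
    have Jg := rad_Lambda_sub_Gamma (rad_Lambda_delta g^-1%g).
    have [_ /(_ h) Oag] := (aJ _ Jg).1.
    move: Oag; rewrite mulrBr mulr1 !galgB_E !mulr_galg_delta !invgK mul1g !aE.
    by rewrite second_difference_div -!tofracB tofrac_div_pi !rmorphB => /eqP.
  exists b, (pi^-1 * l); split=> //.
    by rewrite mulrA expr2 mulfK ?pi_neq0.
  exists (red (b 1%g)), (fun h => red (b h) - red (b 1%g)).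
    move=> x y; apply/eqP; rewrite -subr_eq0 -[X in _ == X](fE y x).
    by apply/eqP; ring.
  by move=> h; rewrite addrC subrK.
have aug_a : aug a \in padic_integers.
  rewrite ea raddfD /= !augZ aug_emb rpredD //.
    by rewrite mulrC tofrac_div_pi (red_sum_affine fM bE).
  have [m ->] := aug_nrmE.
  have -> : k * (pi ^+ 2 * m%:R) = (pi ^+ 2 * k) * m%:R by ring.
  by rewrite (rpredM Ok) // rpred_nat.
split=> y [Gy Oy].
all: split; last by rewrite augM 1?[aug y * _]mulrC -mulrA rpredM.
  case/GammaP: Gy Oy => x [l [/Lambda_emb[d ->] Ol ->]] Oy.
  have Od := aug_div_pi Ol Oy.
  rewrite mulrDr -scalerAr mulr_nrm scalerA.
  apply: GammaD; last by apply: Gamma_nrm; rewrite mulrA rpredM.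
  rewrite ea mulrDl -!scalerAl nrm_mulr scalerA embM; apply: GammaD.
    apply: Gamma_emb_div; apply: (red_conv_affine_l fM bE).
    by apply/eqP; rewrite -tofrac_div_pi -aug_emb.
  apply: Gamma_nrm; rewrite (_ : _ * _ = (pi ^+ 2 * k) * (aug (emb d) / pi)).
    by rewrite (rpredM Ok).
  by rewrite (mulr_mul_div pi_neq0) mulrA expr2 !mulrA.
case/GammaP: Gy Oy => x [l [/Lambda_emb[d ->] Ol ->]] Oy.
have Od := aug_div_pi Ol Oy.
rewrite mulrDl -scalerAl nrm_mulr scalerA.
apply: GammaD; last by apply: Gamma_nrm; rewrite mulrA rpredM.
rewrite ea mulrDr -!scalerAr mulr_nrm scalerA embM; apply: GammaD.
  apply: Gamma_emb_div; apply: (red_conv_affine_r fM bE).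
  by apply/eqP; rewrite -tofrac_div_pi -aug_emb.
apply: Gamma_nrm; rewrite (_ : _ * _ = (pi ^+ 2 * k) * (aug (emb d) / pi)).
  by rewrite (rpredM Ok).
by rewrite (mulr_mul_div pi_neq0) mulrA expr2 !mulrA.
Qed.

(** * Transversals and indices over [Lambda] *)

Lemma quotient_card_Gamma : quotient_card Gamma_order Lambda p.
Proof.
pose rep (t : 'F_p) : KG := (iota (Fp_lift p_pr t) / pi) *: nrm.
have repE t g : rep t g = iota (Fp_lift p_pr t) / pi.
  by rewrite galgZ_E nrm_E mulr1.
have rep_pi t : pi * (iota (Fp_lift p_pr t) / pi) = iota (Fp_lift p_pr t).
  by rewrite mulrC divfK ?pi_neq0.
rewrite -[X in quotient_card _ _ X](card_Fp p_pr).
apply: (quotient_card_transversal (f := rep)).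
- exact: Lambda_Gamma.
- exact: Lambda0.
- exact: LambdaB.
- by move=> t; apply: Gamma_nrm; rewrite rep_pi tofrac_padic_integral.
(* The class of [a] is determined by [z = p a(1)] modulo [p]. *)
- move=> a [/integralP[z ez] ag]; exists (red z); apply/LambdaP => g.
  rewrite galgB_E repE.
  have -> : a g = a g - a 1%g + iota z / pi.
    by rewrite -ez mulrAC divff ?pi_neq0 // mul1r subrK.
  rewrite -addrA -mulrBl -tofracB rpredD // tofrac_div_pi.
  by rewrite rmorphB /= Fp_liftK subrr.
- move=> t u /LambdaP/(_ 1%g); rewrite galgB_E !repE -mulrBl -tofracB.
  by rewrite tofrac_div_pi rmorphB /= !Fp_liftK subr_eq0 => /eqP.
Qed.

Lemma quotient_card_Delta :
  quotient_card Delta_order Lambda (p ^ 2 * #|hom_Fp p gT|)%N.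
Proof.
pose H := {f : {ffun gT -> 'F_p} | f \in hom_Fp p gT}.
pose num (i : 'F_p * 'F_p * H) h : Zp := Fp_lift p_pr (i.1.2 + val i.2 h).
pose rep (i : 'F_p * 'F_p * H) : KG :=
  pi^-1 *: emb (num i) + (iota (Fp_lift p_pr i.1.1) / pi / pi) *: nrm.
have repE i g : rep i g
    = pi^-1 * iota (num i g) + iota (Fp_lift p_pr i.1.1) / pi / pi.
  by rewrite galgD_E galgZ_E galgZ_E emb_E nrm_E mulr1.
have -> : (p ^ 2 * #|hom_Fp p gT|)%N = #|{: 'F_p * 'F_p * H}|.
  by rewrite !card_prod card_sig card_Fp // mulnn.
have pi2 z : pi ^+ 2 * (iota z / pi / pi) = iota z.
  by rewrite sqr_div_mul ?pi_neq0.
apply: (quotient_card_transversal (f := rep)).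
- move=> _ /Lambda_emb[b ->]; exists (fun h => p%:R * b h), 0; split.
  + by rewrite mulr0 rpred0.
  + exists 0, (fun=> 0) => [x y | h]; first by rewrite addr0.
    by rewrite red_pM addr0.
  + apply/ffunP => g; rewrite galgD_E !galgZ_E !emb_E mul0r addr0 tofracM.
    by rewrite mulrA mulVf ?pi_neq0 // mul1r.
- exact: Lambda0.
- exact: LambdaB.
- move=> i; exists (num i), (iota (Fp_lift p_pr i.1.1) / pi / pi); split=> //.
    by rewrite pi2 tofrac_padic_integral.
  exists i.1.2, (val i.2); first exact/hom_FpP/(valP i.2).
  by move=> h; rewrite Fp_liftK.
- move=> _ [b [k [/integralP[c ec] [s [f fM bE]] ->]]].
  have {ec} ek : k = iota c / pi / pi.
    by rewrite -ec sqr_mul_div ?pi_neq0.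
  have [z ez] : exists z, c = Fp_lift p_pr (red c) + p%:R * z.
    by apply: red_eqP; rewrite Fp_liftK.
  have fH : [ffun h => f h] \in hom_Fp p gT.
    by apply/hom_FpP => x y; rewrite !ffunE fM.
  (* Replacing [c] by the lift of its residue leaves [p z / p^2 = z / p], a carry into the constant
     [s]. *)
  pose i : 'F_p * 'F_p * H := (red c, s + red z, Sub [ffun h => f h] fH).
  exists i; apply/LambdaP => g; rewrite galgB_E repE galgD_E galgZ_E galgZ_E.
  rewrite emb_E nrm_E mulr1 ek {1}ez tofracD tofracM.
  rewrite carry_div ?pi_neq0 // -tofracD -tofracB tofrac_div_pi.
  apply/eqP; rewrite rmorphB rmorphD /= bE [red (num _ _)]Fp_liftK /= ffunE.
  by rewrite [X in _ - X]addrAC subrr.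
(* Multiplying by [p] isolates the [nrm / p^2] coordinate. Once it cancels, the value at 1 gives
   [s], since [f 1 = 0], and the other values give [f]. *)
- move=> i j /LambdaP Oij; have {}Oij g :
      (iota (num i g) - iota (num j g)) / pi
      + (iota (Fp_lift p_pr i.1.1) - iota (Fp_lift p_pr j.1.1)) / pi / pi
      \in padic_integers.
    by have := Oij g; rewrite galgB_E !repE regroup_div ?pi_neq0.
  have e11 : i.1.1 = j.1.1.
    apply/eqP; rewrite -subr_eq0.
    have := rpredM (tofrac_padic_integral p%:R) (Oij 1%g).
    rewrite mul_carry ?pi_neq0 // -!tofracB rpredDl ?tofrac_padic_integral //.
    by rewrite tofrac_div_pi rmorphB /= !Fp_liftK.
  have eh g : i.1.2 + val i.2 g = j.1.2 + val j.2 g.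
    have := Oij g; rewrite e11 subrr !mul0r addr0 -tofracB tofrac_div_pi.
    by rewrite rmorphB /= !Fp_liftK subr_eq0 => /eqP.
  have f1 (f : H) : val f 1%g = 0 by apply/hom_Fp1/hom_FpP/(valP f).
  have e12 : i.1.2 = j.1.2 by have := eh 1%g; rewrite !f1 !addr0.
  have e2 : i.2 = j.2.
    by apply/val_inj/ffunP => g; have := eh g; rewrite e12 => /addrI.
  by case: i j e11 e12 e2 {Oij eh} => [[? ?] ?] [[? ?] ?] /= -> -> ->.
Qed.

End GroupRing.

Theorem corollary8p2 (p : nat) (p_pr : prime p) (gT : finGroupType)
    (pG : (p.-group [set: gT]%SET)%g) (oG : (p ^ 2 <= #|[set: gT]%SET|)%N) :
  let G := [set: gT]%SET in
  let Lambda := integral_group_ring p_pr gT in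
  let Gamma := Idealizer (jacobson_radical Lambda) in
  let Delta := Idealizer (jacobson_radical Gamma) in
  quotient_card Gamma Lambda p /\
  quotient_card Delta Lambda
    (p ^ 2 * #|(G / (G^`(1) * power_subgroup p G))%g|)%N.
Proof.
move=> G Lambda Gamma Delta.
have GammaE : Gamma = @Gamma_order p p_pr gT.
  by rewrite /Gamma jacobson_radical_Lambda // Idealizer_rad_Lambda.
have DeltaE : Delta = @Delta_order p p_pr gT.
  by rewrite /Delta GammaE jacobson_radical_Gamma // Idealizer_rad_Gamma.
have G_gt1 : (1 < #|[set: gT]%SET|)%N.
  by apply: leq_trans oG; rewrite -{1}(exp1n 2) ltn_exp2r ?prime_gt1.
(* The order of the Frattini quotient is traded for the number of homomorphisms to ['F_p], which
   index the transversal. *)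
rewrite GammaE DeltaE (der_mul_power_subgroup pG) -(card_hom_Fp p_pr pG) //.
split.
  exact: quotient_card_Gamma.
exact: quotient_card_Delta.
Qed.
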